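(* Let $\mathcal{T}$ be a Krull-Schmidt triangulated category. For any silting objects $M,N\in\mathcal{T}$, we have $\delta(M)=\delta(N)$, where $\delta(X)$ denotes the number of non-isomorphic indecomposable direct summands of $X$.
   Context: $\mathcal{T}$ is Krull-Schmidt if any object is isomorphic to a finite coproduct of objects whose endomorphism rings are local. An object $M\in\mathcal{T}$ is silting if $\mathrm{Hom}_{\mathcal{T}}(M,M[i])=0$ for all $i>0$ and the smallest thick subcategory of $\mathcal{T}$ containing $M$ is $\mathcal{T}$. *)

(* Defs.v *)
From HB Require Import structures.
From mathcomp Require Import all_boot all_order all_algebra.
From mathcomp Require Import finmap.
From mathcomp Require Import boolp classical_sets functions cardinality.

Set Implicit Arguments.
Unset Strict Implicit.
Unset Printing Implicit Defensive.

Import GRing.Theory.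
Local Open Scope ring_scope.
Local Open Scope classical_set_scope.

(* The Hom groups are [zmodType]s; under the axioms
   of [boolp] every abelian group carries such a structure. *)

Record preadditive := Preadditive {
  obj :> Type;
  hom : obj -> obj -> zmodType;
  idm : forall X, hom X X;
  comp : forall X Y Z, hom Y Z -> hom X Y -> hom X Z;
  comp1m : forall X Y (f : hom X Y), comp (idm Y) f = f;
  compm1 : forall X Y (f : hom X Y), comp f (idm X) = f;
  compmA : forall W X Y Z (h : hom Y Z) (g : hom X Y) (f : hom W X),
    comp h (comp g f) = comp (comp h g) f;
  compmDl : forall X Y Z (g g' : hom Y Z) (f : hom X Y),
    comp (g + g') f = comp g f + comp g' f;
  compmDr : forall X Y Z (g : hom Y Z) (f f' : hom X Y),
    comp g (f + f') = comp g f + comp g f' }.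

Arguments hom {p} X Y : rename.
Arguments idm {p} X : rename.
Arguments comp {p X Y Z} g f : rename.

Notation "g ∘ f" := (comp g f) (at level 40, left associativity).

Record functor (C D : preadditive) := Functor {
  fobj :> C -> D;
  fmap : forall X Y : C, {additive hom X Y -> hom (fobj X) (fobj Y)};
  fmap1 : forall X : C, fmap X X (idm X) = idm (fobj X);
  fmapM : forall (X Y Z : C) (g : hom Y Z) (f : hom X Y),
    fmap X Z (g ∘ f) = fmap Y Z g ∘ fmap X Y f }.

Arguments fmap {C D} f {X Y} : rename.

Section Preadditive.
Variable C : preadditive.
Implicit Types X Y Z A B : C.

Definition inverse_of X Y (f : hom X Y) (g : hom Y X) :=
  g ∘ f = idm X /\ f ∘ g = idm Y.

Definition is_iso X Y (f : hom X Y) := exists g, inverse_of f g.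

Definition isomorphic X Y := exists f : hom X Y, is_iso f.

Definition is_zero X :=
  forall Y, (forall f : hom X Y, f = 0) /\ (forall f : hom Y X, f = 0).

Definition is_coproduct2 A B Y (i : hom A Y) (j : hom B Y) :=
  forall Z (f : hom A Z) (g : hom B Z),
    exists! h : hom Y Z, h ∘ i = f /\ h ∘ j = g.

Definition is_coproduct (I : Type) (F : I -> C) Y (u : forall i, hom (F i) Y) :=
  forall Z (f : forall i, hom (F i) Z),
    exists! h : hom Y Z, forall i, h ∘ u i = f i.

Definition is_additive :=
  (exists O, is_zero O) /\
  (forall A B, exists Y (i : hom A Y) (j : hom B Y), is_coproduct2 i j).

Definition summand A X :=
  exists B (i : hom A X) (j : hom B X), is_coproduct2 i j.

Definition indecomposable X :=
  ~ is_zero X /\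
  forall A B (i : hom A X) (j : hom B X),
    is_coproduct2 i j -> is_zero A \/ is_zero B.

Definition iso_class X : set C := [set Y | isomorphic X Y].

Definition ind_summands X : set (set C) :=
  [set iso_class Y | Y in [set Y | indecomposable Y /\ summand Y X]].

(* [fset_set] is only meaningful on finite sets; see [finite_ind_summands]
   below for Krull-Schmidt categories. *)
Definition delta X : nat := #|` fset_set (ind_summands X : set {classic set C})|.

Definition endo X : Type := hom X X.
HB.instance Definition _ X := GRing.Zmodule.on (endo X).
HB.instance Definition _ X := GRing.Zmodule_isPzRing.Build (endo X)
  (@compmA C X X X X) (@comp1m C X X) (@compm1 C X X)
  (fun f g h => @compmDl C X X X f g h) (@compmDr C X X X).

End Preadditive.

(* [GRing.unit] requires decidable invertibility, which is not assumed of an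
   endomorphism ring. *)
Definition invertible (R : pzRingType) (a : R) :=
  exists b : R, a * b = 1 /\ b * a = 1.

Definition local_ring (R : pzRingType) :=
  (1 : R) <> 0 /\
  forall a b : R, ~ invertible a -> ~ invertible b -> ~ invertible (a + b).

Definition krull_schmidt (C : preadditive) :=
  forall X : C, exists (n : nat) (F : 'I_n -> C),
    (forall i, local_ring (endo (F i))) /\
    exists (Y : C) (u : forall i, hom (F i) Y),
      is_coproduct u /\ isomorphic X Y.

Definition is_equivalence (C D : preadditive) (S : functor C D) :=
  exists (U : functor D C) (eta : forall X : C, hom X (U (S X)))
         (eps : forall Y : D, hom (S (U Y)) Y),
    [/\ forall X, is_iso (eta X),
        forall (X X' : C) (f : hom X X'),
          fmap U (fmap S f) ∘ eta X = eta X' ∘ f,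
        forall Y, is_iso (eps Y) &
        forall (Y Y' : D) (g : hom Y Y'),
          g ∘ eps Y = eps Y' ∘ fmap S (fmap U g)].

(* The suspension is an additive auto-equivalence, not necessarily a strict
   automorphism. *)
Record triangulated := Triangulated {
  tcat :> preadditive;
  tcat_additive : is_additive tcat;
  shift : functor tcat tcat;
  shift_equiv : is_equivalence shift;
  dist : forall X Y Z : tcat,
    hom X Y -> hom Y Z -> hom Z (shift X) -> Prop;
  dist_id : forall X O : tcat, is_zero O ->
    dist (idm X) (0 : hom X O) (0 : hom O (shift X));
  dist_ex : forall (X Y : tcat) (u : hom X Y),
    exists (Z : tcat) (v : hom Y Z) (w : hom Z (shift X)), dist u v w;
  dist_iso : forall (X Y Z X' Y' Z' : tcat)
      (u : hom X Y) (v : hom Y Z) (w : hom Z (shift X))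
      (u' : hom X' Y') (v' : hom Y' Z') (w' : hom Z' (shift X'))
      (a : hom X X') (b : hom Y Y') (c : hom Z Z'),
    is_iso a -> is_iso b -> is_iso c ->
    b ∘ u = u' ∘ a -> c ∘ v = v' ∘ b -> fmap shift a ∘ w = w' ∘ c ->
    dist u v w -> dist u' v' w';
  dist_rot : forall (X Y Z : tcat)
      (u : hom X Y) (v : hom Y Z) (w : hom Z (shift X)),
    dist u v w <-> dist v w (- fmap shift u);
  dist_mor : forall (X Y Z X' Y' Z' : tcat)
      (u : hom X Y) (v : hom Y Z) (w : hom Z (shift X))
      (u' : hom X' Y') (v' : hom Y' Z') (w' : hom Z' (shift X'))
      (a : hom X X') (b : hom Y Y'),
    dist u v w -> dist u' v' w' -> b ∘ u = u' ∘ a ->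
    exists c : hom Z Z', c ∘ v = v' ∘ b /\ fmap shift a ∘ w = w' ∘ c;
  dist_oct : forall (X Y Z X' Y' Z' : tcat)
      (f : hom X Y) (i : hom Y Z') (j : hom Z' (shift X))
      (g : hom Y Z) (k : hom Z X') (l : hom X' (shift Y))
      (m : hom Z Y') (n : hom Y' (shift X)),
    dist f i j -> dist g k l -> dist (g ∘ f) m n ->
    exists (u : hom Z' Y') (v : hom Y' X'),
      dist u v (fmap shift i ∘ l) /\
      [/\ u ∘ i = m ∘ g, n ∘ u = j, v ∘ m = k & l ∘ v = fmap shift f ∘ n] }.

Arguments shift {t}.
Arguments dist {t X Y Z} u v w.

Section Silting.
Variable T : triangulated.

(* As [shift] is only an equivalence, closure under [-1] is expressed by the
   converse implication in [thick_shift]. *)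
Record thick (S : set T) : Prop := Thick {
  thick_zero : forall O : T, is_zero O -> S O;
  thick_iso : forall X Y : T, isomorphic X Y -> S X -> S Y;
  thick_shift : forall X : T, S X <-> S (shift X);
  thick_cone : forall (X Y Z : T)
      (u : hom X Y) (v : hom Y Z) (w : hom Z (shift X)),
    dist u v w -> S X -> S Y -> S Z;
  thick_summand : forall A X : T, summand A X -> S X -> S A }.

Definition silting (M : T) :=
  (forall i : nat, (0 < i)%N -> forall f : hom M (iter i shift M), f = 0) /\
  smallest thick [set M] = setT.

End Silting.

Section Finiteness.
Variable C : preadditive.
Implicit Types X Y Z A B : C.

Lemma comp0m X Y Z (f : hom X Y) : (0 : hom Y Z) ∘ f = 0.
Proof. by apply: (addrI (0 ∘ f)); rewrite -compmDl !addr0. Qed.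

Lemma compm0 X Y Z (g : hom Y Z) : g ∘ (0 : hom X Y) = 0.
Proof. by apply: (addrI (g ∘ 0)); rewrite -compmDr !addr0. Qed.

Lemma is_zeroP X : is_zero X <-> idm X = 0.
Proof.
split=> [/(_ X) [+ _]|X0 Y]; [exact|split=> f].
  by rewrite -[f]compm1 X0 compm0.
by rewrite -[f]comp1m X0 comp0m.
Qed.

Lemma isomorphic_sym X Y : isomorphic X Y -> isomorphic Y X.
Proof. by case=> f [g [gf fg]]; exists g, f. Qed.

Lemma isomorphic_trans X Y Z :
  isomorphic X Y -> isomorphic Y Z -> isomorphic X Z.
Proof.
case=> f [f' [f'f ff']] [g [g' [g'g gg']]].
exists (g ∘ f), (f' ∘ g'); split.
  by rewrite compmA -(compmA f') g'g compm1.
by rewrite compmA -(compmA g) ff' compm1.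
Qed.

Lemma iso_class_eq X Y : isomorphic X Y -> iso_class X = iso_class Y.
Proof.
move=> XY; apply/seteqP; split=> Z /=; apply: isomorphic_trans => //.
exact: isomorphic_sym.
Qed.

Lemma coproduct2_biproduct A B Y (i : hom A Y) (j : hom B Y) :
  is_coproduct2 i j -> exists (p : hom Y A) (q : hom Y B),
  [/\ p ∘ i = idm A, p ∘ j = 0, q ∘ i = 0, q ∘ j = idm B &
      i ∘ p + j ∘ q = idm Y].
Proof.
move=> ij; have [p [[pi pj] _]] := ij _ (idm A) 0.
have [q [[qi qj] _]] := ij _ 0 (idm B).
exists p, q; split=> //; have [h [_ hu]] := ij _ i j.
rewrite -(hu (idm Y)) ?comp1m; last by [].
apply/esym/hu; rewrite !compmDl -!compmA pi pj qi qj !compm0 !compm1.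
by rewrite addr0 add0r.
Qed.

Lemma local_split_iso X Y (f : hom Y X) (g : hom X Y) :
  local_ring (endo X) -> ~ is_zero Y -> g ∘ f = idm Y -> isomorphic Y X.
Proof.
move=> [X1 Xloc] Y0 gf; pose e : endo X := f ∘ g.
have ee : e * e = e.
  by change (f ∘ g ∘ (f ∘ g) = f ∘ g); rewrite compmA -(compmA f) gf compm1.
case: (pselect (invertible e)) => [[b [eb _]]|ne].
  exists f, g; split=> //; change (e = 1).
  by rewrite -eb -{2}ee -mulrA eb mulr1.
case: (pselect (invertible (1 - e))) => [[b [_ eb]]|ne']; last first.
  case: (Xloc _ _ ne ne'); exists 1; rewrite addrC subrK; split; exact: mulr1.
exfalso; have e0 : e = 0.
  by rewrite -[e]mul1r -eb -mulrA mulrBl mul1r ee subrr mulr0.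
have e0' : f ∘ g = 0 by [].
apply/Y0/is_zeroP; rewrite -gf -[g]comp1m -gf.
by rewrite -(compmA g) e0' compm0 comp0m.
Qed.

Lemma local_sum (R : pzRingType) (I : finType) (a : I -> R) :
  local_ring R -> \sum_i a i = 1 -> exists i, invertible (a i).
Proof.
case=> R1 Rloc s1; apply: contrapT => na.
suff: ~ invertible (\sum_i a i) by apply; exists 1; rewrite s1 mulr1.
apply: (big_ind (fun x => ~ invertible x)) => [[b [+ _]]||i _ ai].
- by rewrite mul0r => /esym.
- exact: Rloc.
- by apply: na; exists i.
Qed.

Lemma ord_rect0 n (K : 'I_n.+1 -> Type) (k0 : K ord0)
    (kS : forall j, K (lift ord0 j)) :
  exists k : forall j, K j, k ord0 = k0 /\ forall j, k (lift ord0 j) = kS j.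
Proof.
exists (fun j => match unliftP ord0 j with
  | UnliftSome i e => eq_rect_r K (kS i) e
  | UnliftNone e => eq_rect_r K k0 e end); split=> [|j].
  by case: unliftP => [i e|e] //; rewrite (eq_irrelevance e erefl).
case: unliftP => [i e|//].
have ij := lift_inj e; rewrite -ij in e *.
by rewrite (eq_irrelevance e erefl).
Qed.

Lemma coproduct_biproduct (I : finType) (F : I -> C) Y
    (u : forall i, hom (F i) Y) :
  is_coproduct u -> exists p : forall i, hom Y (F i),
  \sum_i u i ∘ p i = idm Y.
Proof.
move=> cu; pose d i j : hom (F j) (F i) :=
  if @eqP _ j i is ReflectT e
  then eq_rect_r (fun k => hom (F k) (F i)) (idm _) e else 0.
have dii i : d i i = idm _.
  by rewrite /d; case: eqP => // e; rewrite (eq_irrelevance e erefl).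
have dij i j : j != i -> d i j = 0 by rewrite /d; case: eqP.
pose p i := projT1 (cid (cu (F i) (d i))).
have pE i j : p i ∘ u j = d i j by rewrite /p; case: cid => h [].
exists p; have [h [_ hu]] := cu _ u.
rewrite -(hu (idm Y)) => [|i]; last by rewrite comp1m.
apply/esym/hu => j.
have -> : (\sum_i u i ∘ p i) ∘ u j = \sum_i u i ∘ (p i ∘ u j).
  rewrite (big_morph (fun h => h ∘ u j)
    (fun x y => compmDl x y (u j)) (comp0m _ (u j))).
  by apply: eq_bigr => i _; rewrite compmA.
rewrite (bigD1 j) //= big1 => [|i ij].
  by rewrite pE dii compm1 addr0.
by rewrite pE dij ?compm0 // eq_sym.
Qed.

Lemma finite_coproduct : is_additive C -> forall n (F : 'I_n -> C),
  exists Y (u : forall i, hom (F i) Y), is_coproduct u.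
Proof.
case=> [[O O0] cop2]; elim=> [F|n IHn F].
  exists O, (fun=> 0) => Z f.
  by exists 0; split=> [[]//|h _]; apply/esym/(O0 Z).1.
have [R [r cr]] := IHn (fun j => F (lift ord0 j)).
have [Y [i [j cij]]] := cop2 (F ord0) R.
have [u [u0 uS]] := @ord_rect0 _ (fun k => hom (F k) Y) i (fun k => j ∘ r k).
exists Y, u => Z f.
have [g [gr gu]] := cr _ (fun k => f (lift ord0 k)).
have [h [[hi hj] hu]] := cij _ (f ord0) g.
exists h; split=> [k|h' h'u].
  case: (unliftP ord0 k) => [k' ->|->]; last by rewrite u0.
  by rewrite uS compmA hj.
apply: hu; split; first by rewrite -u0.
by apply/esym/gu => k; rewrite -compmA -uS.
Qed.

Lemma coproduct_split n (F : 'I_n.+1 -> C) Y (u : forall i, hom (F i) Y) :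
  is_additive C -> is_coproduct u ->
  exists R (j : hom R Y), is_coproduct2 (u ord0) j.
Proof.
move=> addC cu.
have [R [r cr]] := finite_coproduct addC (fun j => F (lift ord0 j)).
have [j [jr _]] := cr _ (fun k => u (lift ord0 k)).
exists R, j => Z f g.
have [v [v0 vS]] := @ord_rect0 _ (fun k => hom (F k) Z) f (fun k => g ∘ r k).
have [h [hv hu]] := cu _ v.
exists h; split=> [|h' [h'0 h'j]].
  split; first by rewrite hv.
  have [g' [_ gu]] := cr _ (fun k => g ∘ r k).
  rewrite -(gu g) //; apply/esym/gu => k.
  by rewrite -compmA jr hv vS.
apply: hu => k; case: (unliftP ord0 k) => [k' ->|->]; last by rewrite h'0.
by rewrite -jr compmA h'j vS.
Qed.

Lemma indecomposable_local X : is_additive C -> krull_schmidt C ->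
  indecomposable X -> exists Y, local_ring (endo Y) /\ isomorphic X Y.
Proof.
move=> addC KS [X0 Xind]; have [n [F [Floc [Y [u [cu XY]]]]]] := KS X.
case: n F Floc u cu => [|n] F Floc u cu.
  have Y0 : idm Y = 0.
    have [h [_ hu]] := cu Y (fun i => 0).
    by rewrite -(hu 0) ?(hu (idm Y)) //; case.
  case: X0; apply/is_zeroP; case: XY => f [g [gf fg]].
  by rewrite -gf -[f]comp1m Y0 comp0m compm0.
have [R [j cj]] := coproduct_split addC cu.
have [f [g [gf fg]]] := XY.
have cX : is_coproduct2 (g ∘ u ord0) (g ∘ j).
  move=> Z a b; have [h [[ha hb] hu]] := cj _ a b.
  exists (h ∘ f); split=> [|h' [h'a h'b]].
    by rewrite !compmA -!(compmA h f g) fg compm1.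
  by rewrite (hu (h' ∘ g)) -?compmA // gf compm1.
exists (F ord0); split=> //.
have [F0|R0] := Xind _ _ _ _ cX.
  by case: (Floc ord0) => + _; case; apply/is_zeroP.
have [p [q [pi pj qi qj e]]] := coproduct2_biproduct cX.
exists p, (g ∘ u ord0); split=> //.
by rewrite -e [q](R0 _).2 compm0 addr0.
Qed.

Lemma finite_ind_summands X : is_additive C -> krull_schmidt C ->
  finite_set (ind_summands X).
Proof.
move=> addC KS; have [n [F [Floc [Y [u [cu XY]]]]]] := KS X.
apply: (@sub_finite_set _ _ [set iso_class (F i) | i in [set: 'I_n]]).
  move=> _ [A [Aind [B [a [b cab]]]] <-].
  have [A' [A'loc AA']] := indecomposable_local addC KS Aind.
  suff [i A'F] : exists i, isomorphic A' (F i).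
    by exists i => //; apply/esym/iso_class_eq/(isomorphic_trans AA' A'F).
  have [p [_ [pa _ _ _ _]]] := coproduct2_biproduct cab.
  have [v ve] := coproduct_biproduct cu.
  have [s [s' [s's ss']]] := AA'; have [t [t' [t't tt']]] := XY.
  pose f : hom A' Y := t ∘ a ∘ s'; pose g : hom Y A' := s ∘ p ∘ t'.
  have gf : g ∘ f = idm A'.
    by rewrite /g /f !compmA -(compmA _ t') t't compm1 -(compmA s) pa compm1.
  have sum1 : \sum_i (g ∘ u i ∘ (v i ∘ f) : endo A') = 1.
    rewrite -[RHS]gf -[f in RHS]comp1m -ve.
    rewrite (big_morph (fun h => h ∘ f)
      (fun x y => compmDl x y f) (comp0m _ f)).
    rewrite (big_morph (fun h => g ∘ h) (compmDr g) (compm0 _ g)).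
    by apply: eq_bigr => i _; rewrite !compmA.
  have [i [w [_ wi]]] := local_sum A'loc sum1; exists i.
  apply: (@local_split_iso _ _ (v i ∘ f) (w ∘ (g ∘ u i))) => //.
    by move/is_zeroP => A'0; case: A'loc => + _; apply.
  by rewrite -compmA.
exact/finite_image/finite_finset.
Qed.

End Finiteness.

(* Main.v *)
From HB Require Import structures.
From mathcomp Require Import all_boot all_order all_algebra.
From mathcomp Require Import finmap.
From mathcomp Require Import boolp classical_sets functions cardinality.
Require Import Defs.

Set Implicit Arguments.
Unset Strict Implicit.
Unset Printing Implicit Defensive.

Import GRing.Theory.
Local Open Scope ring_scope.
Local Open Scope classical_set_scope.

(** For a silting object [M], the classes of its non-isomorphic indecomposable
    summands form a basis of the Grothendieck group of [T], whose rank does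
    therefore not depend on [M].  The Grothendieck group enters only through
    integer functions that are additive on triangles.

    Generation ([silting_span]): the objects some shift of which is an iterated
    extension of objects [P_0], [P_1[1]], ..., [P_l[l]], with [P_i] in add [M],
    form a thick subcategory ([thick_filt]), hence are all objects.  Closure
    under extensions ([filt_tri]) holds because factors in the wrong order have
    no extensions between them and can be exchanged.  Closure under summands
    ([filt_retract]) reduces to [retract_cone]: if [C] is the cone of an add
    [M]-approximation [P -> E], and [A] is a retract of [E], then the cone of
    [P -> E -> A] is a retract of [C ⊕ P[1]].

    Linear independence ([split_additive_extend]): the alternating sum of a
    split additive function over the factors of such a filtration does not
    depend on the filtration ([filt_unique], by Schanuel's lemma) and is additive
    on triangles.  This applies to the multiplicity of an indecomposable object
    with local endomorphism ring, which is well defined and additive since such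
    an object can be cancelled from direct sums ([biproduct_cancel]).

    For two silting objects, expressing the classes of one family by the other
    gives a rectangular matrix with a right inverse, hence an inequality between
    the numbers of summands ([silting_delta_le]); by symmetry they are equal. *)

(** * Preadditive categories *)

Section PreadditiveTheory.
Variable C : preadditive.
Implicit Types A B L X Y Z : C.

Lemma compmN X Y Z (g : hom Y Z) (f : hom X Y) : g ∘ (- f) = - (g ∘ f).
Proof. by apply: (addrI (g ∘ f)); rewrite -compmDr !subrr compm0. Qed.

Lemma compNm X Y Z (g : hom Y Z) (f : hom X Y) : (- g) ∘ f = - (g ∘ f).
Proof. by apply: (addrI (g ∘ f)); rewrite -compmDl !subrr comp0m. Qed.

Lemma compmBr X Y Z (g : hom Y Z) (f f' : hom X Y) :
  g ∘ (f - f') = g ∘ f - g ∘ f'.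
Proof. by rewrite compmDr compmN. Qed.

Lemma compmBl X Y Z (g g' : hom Y Z) (f : hom X Y) :
  (g - g') ∘ f = g ∘ f - g' ∘ f.
Proof. by rewrite compmDl compNm. Qed.

(** Substitutes for [g ∘ f] at the right end of a left-associated composite. *)
Lemma compK W X Y Z (g : hom X Y) (f : hom W X) h
  (e : g ∘ f = h) (k : hom Y Z) : k ∘ g ∘ f = k ∘ h.
Proof. by rewrite -e; rewrite compmA. Qed.

Lemma isomorphic_refl X : isomorphic X X.
Proof. by exists (idm X), (idm X); split; rewrite comp1m. Qed.

Lemma is_iso_idm X : is_iso (idm X).
Proof. by exists (idm X); split; rewrite comp1m. Qed.

(** * Retracts and biproducts *)

(** [A] is a split subobject of [X]; no complement is required to exist. *)
Definition retract A X := exists (i : hom A X) (p : hom X A), p ∘ i = idm A.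

Lemma retract_trans A X Y : retract A X -> retract X Y -> retract A Y.
Proof.
move=> [i [p pi]] [j [q qj]]; exists (j ∘ i), (p ∘ q).
by rewrite compmA -(compmA p) qj compm1.
Qed.

Lemma iso_retract X Y : isomorphic X Y -> retract X Y.
Proof. by move=> [f [g [gf _]]]; exists f, g. Qed.

Lemma retract_zero A O : is_zero O -> retract A O -> is_zero A.
Proof.
by move=> O0 [i [p pi]]; apply/is_zeroP; rewrite -pi ((O0 A).1 p) comp0m.
Qed.

(** The equations of a biproduct: [Y] is the direct sum of [A] and [B] with
    inclusions [i], [j] and projections [p], [q]. *)
Definition bieq A B Y (i : hom A Y) (j : hom B Y) (p : hom Y A) (q : hom Y B) :=
  [/\ p ∘ i = idm A, p ∘ j = 0, q ∘ i = 0, q ∘ j = idm B &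
      i ∘ p + j ∘ q = idm Y].

Definition biproduct A B Y := exists i j p q, @bieq A B Y i j p q.

Lemma bieq_coproduct2 A B Y (i : hom A Y) (j : hom B Y) p q :
  bieq i j p q -> is_coproduct2 i j.
Proof.
move=> [pi pj qi qj e] Z f g; exists (f ∘ p + g ∘ q); split=> [|h [<- <-]].
  rewrite !compmDl -!compmA pi pj qi qj.
  by rewrite !compm1 !compm0 addr0 add0r.
by rewrite -!compmA -compmDr e compm1.
Qed.

Lemma biproduct_summand A B Y : biproduct A B Y -> summand A Y.
Proof.
by move=> [i [j [p [q e]]]]; exists B, i, j; apply: bieq_coproduct2 e.
Qed.

Lemma coproduct2_biproductW A B Y (i : hom A Y) (j : hom B Y) :
  is_coproduct2 i j -> biproduct A B Y.
Proof. by move/coproduct2_biproduct=> [p [q e]]; exists i, j, p, q. Qed.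

Lemma summand_retract A X : summand A X -> retract A X.
Proof. by move=> [B [i [j /coproduct2_biproduct[p [q []]]]]]; exists i, p. Qed.

Lemma biproductC A B Y : biproduct A B Y -> biproduct B A Y.
Proof.
move=> [i [j [p [q [pi pj qi qj e]]]]]; exists j, i, q, p.
by split=> //; rewrite addrC.
Qed.

Lemma biproduct_retract A B Y : biproduct A B Y -> retract A Y.
Proof. by move=> [i [j [p [q []]]]]; exists i, p. Qed.

Lemma biproduct_iso A A' B B' Y Y' : isomorphic A A' -> isomorphic B B' ->
  isomorphic Y Y' -> biproduct A B Y -> biproduct A' B' Y'.
Proof.
move=> [a [a' [a'a aa']]] [b [b' [b'b bb']]] [y [y' [y'y yy']]].
move=> [i [j [p [q [pi pj qi qj e]]]]].
have E U V (f : hom U Y) (g : hom Y V) : g ∘ y' ∘ (y ∘ f) = g ∘ f.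
  by rewrite compmA -(compmA g) y'y compm1.
exists (y ∘ (i ∘ a')), (y ∘ (j ∘ b')), (a ∘ p ∘ y'), (b ∘ q ∘ y'); split.
- by rewrite E compmA -(compmA a) pi compm1.
- by rewrite E compmA -(compmA a) pj compm0 comp0m.
- by rewrite E compmA -(compmA b) qi compm0 comp0m.
- by rewrite E compmA -(compmA b) qj compm1.
have F U V (f : hom U Y) (a1 : hom Y U) (u : hom U V) (v : hom V U) :
    v ∘ u = idm U -> y ∘ (f ∘ v) ∘ (u ∘ a1 ∘ y') = y ∘ (f ∘ a1) ∘ y'.
  by move=> vu; rewrite !compmA -(compmA (y ∘ f)) vu compm1.
by rewrite !F // -compmDl -compmDr e compm1.
Qed.

Lemma biproduct0 X O : is_zero O -> biproduct X O X.
Proof.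
move=> O0; exists (idm X), 0, (idm X), 0; split;
  rewrite ?comp1m ?compm1 ?compm0 ?addr0 //.
by apply/esym/is_zeroP.
Qed.

(** If [Y = A ⊕ B] and [A = L ⊕ A'], then [Y = L ⊕ (A' ⊕ B)]. *)
Lemma biproductA A A' B L Y : is_additive C -> biproduct A B Y ->
  biproduct L A' A -> exists2 W, biproduct A' B W & biproduct L W Y.
Proof.
move=> [_ cop] [i [j [p [q [pi pj qi qj e]]]]].
move=> [i' [j' [p' [q' [pi' pj' qi' qj' e']]]]].
have [W [s [t /coproduct2_biproduct[s' [t' [ss st ts tt E]]]]]] := cop A' B.
exists W; first by exists s, t, s', t'.
exists (i ∘ i'), (i ∘ j' ∘ s' + j ∘ t'), (p' ∘ p), (s ∘ q' ∘ p + t ∘ q).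
split; rewrite ?compmDl ?compmDr ?compmA ?(compK pi) ?(compK pj) ?(compK qi)
  ?(compK qj) ?(compK ss) ?(compK st) ?(compK ts) ?(compK tt) ?compm1 ?compm0
  ?comp0m ?addr0 ?add0r //.
- by rewrite pj' comp0m.
- by rewrite (compK qi') compm0.
- by rewrite (compK qj') compm1.
by rewrite addrA -!(compmA i) -compmDr -compmDl e' comp1m.
Qed.

(** * Objects with local endomorphism ring *)

Lemma local_nonzero L : local_ring (endo L) -> ~ is_zero L.
Proof. by move=> [+ _] /is_zeroP L0; apply. Qed.

Lemma local_invertible_add L (f g : endo L) : local_ring (endo L) ->
  invertible (f + g) -> invertible f \/ invertible g.
Proof.
move=> [_ loc] fg; case: (pselect (invertible f)); first by left.
by move=> nf; right; apply: contrapT => ng; case: (loc _ _ nf ng).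
Qed.

Lemma retract_local L X (f : hom L X) (g : hom X L) :
  invertible (g ∘ f : endo L) -> retract L X.
Proof.
move=> [b [_ bgf]]; exists f, ((b : hom L L) ∘ g).
by rewrite -compmA; exact: bgf.
Qed.

Lemma local_retract_iso L X : local_ring (endo L) -> local_ring (endo X) ->
  retract L X -> isomorphic L X.
Proof.
move=> Lloc Xloc [i [p pi]]; apply: (local_split_iso (f := i) (g := p)) => //.
exact: local_nonzero.
Qed.

(** The identity of [L] is the sum of its components through [A] and [B], one of
    which is invertible. *)
Lemma local_retract_biproduct L A B Y : local_ring (endo L) ->
  biproduct A B Y -> retract L Y -> retract L A \/ retract L B.
Proof.
move=> Lloc [i [j [p [q [_ _ _ _ e]]]]] [f [g gf]].
have /(local_invertible_add Lloc) [] :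
    invertible ((g ∘ i ∘ (p ∘ f) : endo L) + (g ∘ j ∘ (q ∘ f) : endo L)).
  suff -> : (g ∘ i ∘ (p ∘ f) : endo L) + (g ∘ j ∘ (q ∘ f) : endo L) = 1.
    by exists 1; rewrite mulr1.
  rewrite -[RHS]gf -[f in RHS]comp1m -e compmDl compmDr.
  by rewrite !compmA.
- by move/retract_local; left.
- by move/retract_local; right.
Qed.


(** One-sided inverses in a local ring are two-sided. *)
Lemma local_linv (R : pzRingType) (a b : R) : local_ring R ->
  invertible (a * b) -> invertible b.
Proof.
move=> [R1 loc] [c [abc cab]]; set d := c * a.
have db : d * b = 1 by rewrite /d -mulrA.
have ee : (b * d) * (b * d) = b * d by rewrite -mulrA (mulrA d) db mul1r.
suff bd1 : b * d = 1 by exists d.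
case: (pselect (invertible (b * d))) => [[x [ex _]]|ne].
  by rewrite -ex -{2}ee -mulrA ex mulr1.
case: (pselect (invertible (1 - b * d))) => [[x [_ xe]]|ne']; last first.
  by case: (loc _ _ ne ne'); exists 1; rewrite addrC subrK; split; exact: mulr1.
have bd0 : b * d = 0.
  by rewrite -[b * d]mul1r -xe -mulrA mulrBl mul1r ee subrr mulr0.
case: R1; transitivity (d * (b * d) * b); first by rewrite mulrA db mul1r db.
by rewrite bd0 mulr0 mul0r.
Qed.

(** Gaussian elimination: [L] cancels when its component [p' ∘ i] is
    invertible, the isomorphism [A -> B] being the Schur complement of this
    entry. *)
Lemma biproduct_cancel_inv L A B X (i : hom L X) (j : hom A X) p q
    (i' : hom L X) (j' : hom B X) p' q' :
  bieq i j p q -> bieq i' j' p' q' -> invertible (p' ∘ i : endo L) ->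
  isomorphic A B.
Proof.
move=> [pi pj qi qj e] [pi' pj' qi' qj' e'] [b0 [ab0 ba0]].
pose b : hom L L := b0.
have {ab0} ab : p' ∘ i ∘ b = idm L by [].
have {ba0} ba : b ∘ (p' ∘ i) = idm L by [].
pose t := idm X - i ∘ b ∘ p'.
have ti : t ∘ i = 0.
  by rewrite compmBl comp1m -compmA (compK ba) compm1 subrr.
have pt : p' ∘ t = 0.
  by rewrite compmBr compm1 !compmA ab comp1m subrr.
have qt : q ∘ t = q.
  by rewrite compmBr compm1 !compmA qi !comp0m subr0.
have tj' : t ∘ j' = j'.
  by rewrite compmBl comp1m -compmA pj' compm0 subr0.
exists (q' ∘ t ∘ j), (q ∘ j'); split.
  have -> : q ∘ j' ∘ (q' ∘ t ∘ j) = q ∘ (j' ∘ q') ∘ t ∘ j by rewrite !compmA.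
  have -> : j' ∘ q' = idm X - i' ∘ p' by rewrite -e' addrC addKr.
  rewrite compmBr compm1 !compmBl (compmA q i') (compK pt).
  by rewrite compm0 comp0m subr0 qt qj.
have -> : q' ∘ t ∘ j ∘ (q ∘ j') = q' ∘ (t ∘ (j ∘ q)) ∘ j' by rewrite !compmA.
have -> : j ∘ q = idm X - i ∘ p by rewrite -e addrC addKr.
by rewrite compmBr compm1 compmA ti comp0m subr0 -compmA tj' qj'.
Qed.

(** Objects with local endomorphism ring may be cancelled.  If the component
    [p' ∘ i] is not invertible, a transvection of the second decomposition
    makes it so. *)
Lemma biproduct_cancel L A B X : local_ring (endo L) ->
  biproduct L A X -> biproduct L B X -> isomorphic A B.
Proof.
move=> Lloc [i [j [p [q b1]]]] [i' [j' [p' [q' b2]]]].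
case: (pselect (invertible (p' ∘ i : endo L))) => [|ninv].
  exact: biproduct_cancel_inv b1 b2.
have [pi _ _ _ _] := b1; have [pi' pj' qi' qj' e'] := b2.
have inv : invertible (p ∘ j' ∘ (q' ∘ i) : endo L).
  (* [p i = 1] is the sum of its components through [L] and [B], and the first
     is not invertible. *)
  have [//|/(local_linv (a := p ∘ i' : endo L) Lloc)//] :
    invertible (p ∘ j' ∘ (q' ∘ i) : endo L) \/
    invertible ((p ∘ i' : endo L) * (p' ∘ i : endo L)).
  apply: local_invertible_add => //; exists 1; rewrite mulr1 mul1r.
  suff -> : (p ∘ j' ∘ (q' ∘ i) : endo L) + (p ∘ i' : endo L) * (p' ∘ i : endo L)
     = 1 by [].
  rewrite -[RHS]pi -[p in RHS]compm1 -e' compmDr compmDl !compmA addrC.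
  by rewrite /GRing.mul /= !compmA.
(* With [p' + p j' q'] as projection to [L], the component of [i] is
   [p' i + p j' q' i], the sum of a non-invertible and an invertible one. *)
apply: (@biproduct_cancel_inv L A B X i j p q
  i' (j' - i' ∘ p ∘ j') (p' + p ∘ j' ∘ q') q' b1).
  split.
  - by rewrite compmDl pi' -compmA qi' compm0 addr0.
  - rewrite compmBr !compmDl pj' add0r -!compmA qj' compm1.
    by rewrite (compmA p') pi' comp1m (compmA q' i') qi' comp0m !compm0 addr0
      subrr.
  - exact: qi'.
  - by rewrite compmBr qj' -compmA compmA qi' comp0m subr0.
  by rewrite compmDr compmBl !compmA addrACA subrr addr0.
case: Lloc => _ loc; apply: contrapT => ninv'.
have nN (a : endo L) : ~ invertible a -> ~ invertible (- a).
  by move=> na [b [ab ba]]; apply: na; exists (- b);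
    rewrite mulrN mulNr -mulNr -mulrN.
apply: (loc _ _ ninv' (nN _ ninv)).
suff -> : ((p' + p ∘ j' ∘ q') ∘ i : endo L) + - (p' ∘ i : endo L) =
  (p ∘ j' ∘ (q' ∘ i) : endo L) by [].
by rewrite compmDl -compmA [LHS]addrAC subrr add0r.
Qed.

(** * Multiplicities *)

(** [mult L X n]: the object [X] is the direct sum of [n] copies of [L] and an
    object of which [L] is not a retract. *)
Inductive mult L : C -> nat -> Prop :=
| mult0 X : ~ retract L X -> mult L X 0
| multS A X n : biproduct L A X -> mult L A n -> mult L X n.+1.

Lemma mult_iso L X Y n : isomorphic X Y -> mult L X n -> mult L Y n.
Proof.
move=> XY mX; case: mX XY => [X' nX XY|A X' m bX mA XY].
  apply: mult0 => LY; apply/nX/(retract_trans LY)/iso_retract.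
  exact: isomorphic_sym.
apply: multS mA; apply: biproduct_iso bX => //; exact: isomorphic_refl.
Qed.

Lemma mult_unique L X n m : local_ring (endo L) ->
  mult L X n -> mult L X m -> n = m.
Proof.
move=> Lloc mX; elim: mX m => {X n} [X nX|A X n bA mA IH] m mX.
  by case: mX nX => // A X' k /biproduct_retract LX _ [].
case: mX bA => [X' nX /biproduct_retract//|B X' k bB mB bA].
by rewrite (IH k) //; apply: mult_iso mB; apply: biproduct_cancel bB bA.
Qed.

(** If [L] is a retract of neither remainder, it is not one of their sum. *)
Lemma mult_biproduct L A B Y n m : is_additive C -> local_ring (endo L) ->
  biproduct A B Y -> mult L A n -> mult L B m -> mult L Y (n + m).
Proof.
move=> addC Lloc AB mA.
elim: mA B Y m AB => {A n} [A nA|A' A n bA mA IH] B Y m AB mB.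
  elim: mB A nA Y AB => {B m} [B nB|B' B m bB mB IH] A nA Y AB.
    by apply: mult0 => /(local_retract_biproduct Lloc AB) [].
  have [W /biproductC bW LW] := biproductA addC (biproductC AB) bB.
  by rewrite add0n; apply: multS LW _; apply: (IH _ nA).
have [W bW LW] := biproductA addC AB bA.
by apply: multS LW _; apply: IH bW mB.
Qed.

(** Induction along a Krull-Schmidt decomposition of [X]. *)
Lemma krull_schmidt_ind (Q : C -> Prop) : is_additive C -> krull_schmidt C ->
  (forall O, is_zero O -> Q O) ->
  (forall A B Y, biproduct A B Y -> Q A -> Q B -> Q Y) ->
  forall X, (forall L, local_ring (endo L) -> retract L X -> Q L) -> Q X.
Proof.
move=> addC KS Q0 Q2 X QL; have [n [F [Floc [Y [u [cu XY]]]]]] := KS X.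
have Qiso A B : isomorphic A B -> Q A -> Q B.
  move=> AB QA; have [O O0] := addC.1.
  apply: (Q2 A O) => //; last exact: Q0.
  by apply: biproduct_iso (biproduct0 A O0) => //; apply: isomorphic_refl.
have QF i : Q (F i).
  apply: QL => //; apply: retract_trans (iso_retract (isomorphic_sym XY)).
  exists (u i).
  pose d j : hom (F j) (F i) :=
    if @eqP _ j i is ReflectT e
    then eq_rect_r (fun k => hom (F k) (F i)) (idm _) e else 0.
  have [h [hu _]] := cu _ d; exists h; rewrite hu /d.
  by case: eqP => // e; rewrite (eq_irrelevance e erefl).
suff [Y' [u' [cu' QY']]] :
    exists (Y' : C) (u' : forall i, hom (F i) Y'), is_coproduct u' /\ Q Y'.
  apply: (Qiso Y'); last by [].
  apply: isomorphic_sym; apply: isomorphic_trans XY _.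
  have [f [fu _]] := cu _ u'; have [g [gu _]] := cu' _ u.
  exists f, g; split.
    have [h [_ hu]] := cu _ u.
    rewrite -(hu (idm Y)) => [|i]; last by rewrite comp1m.
    by apply/esym/hu => i; rewrite -compmA fu gu.
  have [h [_ hu]] := cu' _ u'.
  rewrite -(hu (idm Y')) => [|i]; last by rewrite comp1m.
  by apply/esym/hu => i; rewrite -compmA gu fu.
move: F QF {Floc u cu}; elim: n => [|n IHn] F QF.
  have [[O O0] _] := addC; exists O, (fun=> 0); split; last exact: Q0.
  move=> Z f; exists 0; split=> [[]//|h _]; exact/esym/(O0 Z).1.
have [R [r [cr QR]]] := IHn (fun j => F (lift ord0 j)) (fun j => QF _).
have [Y' [i [j cij]]] := addC.2 (F ord0) R.
have [v [v0 vS]] := @ord_rect0 _ (fun k => hom (F k) Y') i (fun k => j ∘ r k).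
exists Y', v; split; last exact: Q2 (coproduct2_biproductW cij) _ _.
move=> Z f.
have [g [gr gu]] := cr _ (fun k => f (lift ord0 k)).
have [h [[hi hj] hu]] := cij _ (f ord0) g.
exists h; split=> [k|h' h'v].
  case: (unliftP ord0 k) => [k' ->|->]; last by rewrite v0.
  by rewrite vS compmA hj.
apply: hu; split; first by rewrite -v0.
by apply/esym/gu => k; rewrite -compmA -vS.
Qed.

Lemma mult_exists L X : is_additive C -> krull_schmidt C ->
  local_ring (endo L) -> exists n, mult L X n.
Proof.
move=> addC KS Lloc.
apply: (krull_schmidt_ind (Q := fun X => exists n, mult L X n)) => //
  [O O0|A B Y AB [n mA] [m mB]|L' L'loc _].
- by exists 0; apply: mult0 => /(retract_zero O0); apply: local_nonzero.
- by exists (n + m)%N; apply: mult_biproduct AB mA mB.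
have [LL'|nLL'] := pselect (isomorphic L L'); last first.
  by exists 0; apply: mult0 => /local_retract_iso-/(_ Lloc L'loc).
have [O O0] := addC.1.
exists 1; apply: (@multS _ O); last first.
  by apply: mult0 => /(retract_zero O0); apply: local_nonzero.
apply: biproduct_iso LL' (biproduct0 L O0); exact: isomorphic_refl.
Qed.

(** Integer functions that are additive on direct sums; these are the
    homomorphisms from the split Grothendieck group to the integers. *)
Definition split_additive (f : C -> int) :=
  forall A B Y, biproduct A B Y -> f Y = f A + f B.

Lemma split_additive0 f O : split_additive f -> is_zero O -> f O = 0.
Proof.
move=> fD O0; apply: (addrI (f O)); rewrite addr0 -(fD O O O) //.
exact: biproduct0.
Qed.

Lemma split_additive_iso f X Y : is_additive C -> split_additive f ->
  isomorphic X Y -> f X = f Y.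
Proof.
move=> [[O O0] _] fD XY.
rewrite -[LHS]addr0 -(split_additive0 fD O0) -(fD X O Y) //.
apply: biproduct_iso XY (biproduct0 X O0); exact: isomorphic_refl.
Qed.

(** The multiplicity of [L] as a split additive function. *)
Lemma multiplicity L : is_additive C -> krull_schmidt C ->
  local_ring (endo L) -> exists f : C -> int, [/\ split_additive f, f L = 1 &
  forall L', local_ring (endo L') -> ~ isomorphic L' L -> f L' = 0].
Proof.
move=> addC KS Lloc; have ex X := cid (mult_exists X addC KS Lloc).
pose f X : int := (projT1 (ex X))%:Z.
have fE X n : mult L X n -> f X = n%:Z.
  by rewrite /f; case: (ex X) => m mX /= nX; rewrite (mult_unique Lloc mX nX).
have [O O0] := addC.1.
exists f; split=> [A B Y AB||L' L'loc nLL'].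
- have [n mA] := mult_exists A addC KS Lloc.
  have [m mB] := mult_exists B addC KS Lloc.
  by rewrite (fE _ _ mA) (fE _ _ mB) -PoszD; apply/fE/(mult_biproduct _ _ AB).
- apply: (fE _ 1); apply: multS (biproduct0 L O0) _.
  by apply: mult0 => /(retract_zero O0); apply: local_nonzero.
apply: (fE _ 0); apply: mult0 => /local_retract_iso-/(_ Lloc L'loc) LL'.
exact/nLL'/isomorphic_sym.
Qed.

Lemma local_indecomposable L : local_ring (endo L) -> indecomposable L.
Proof.
move=> Lloc; split=> [|A B i j /coproduct2_biproduct[p [q [pi pj qi qj e]]]].
  exact: local_nonzero.
have : invertible ((i ∘ p : endo L) + (j ∘ q : endo L)).
  suff -> : (i ∘ p : endo L) + (j ∘ q : endo L) = 1.
    by exists 1; rewrite mulr1.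
  exact: e.
case/(local_invertible_add Lloc) => -[b [ab _]]; [right|left]; apply/is_zeroP.
  rewrite -qj -[j]comp1m -[idm L]ab.
  by rewrite /GRing.mul /= !compmA qi !comp0m.
rewrite -pi -[i]comp1m -[idm L]ab.
by rewrite /GRing.mul /= !compmA pj !comp0m.
Qed.

End PreadditiveTheory.

(** * Additive functors and equivalences *)

Section Equivalence.
Variables (C D : preadditive) (S : functor C D).

Lemma fmap_iso X Y : isomorphic X Y -> isomorphic (S X) (S Y).
Proof.
by case=> f [g [gf fg]]; exists (fmap S f), (fmap S g);
  split; rewrite -fmapM ?gf ?fg fmap1.
Qed.

Lemma fmap_retract A X : retract A X -> retract (S A) (S X).
Proof.
by case=> i [p pi]; exists (fmap S i), (fmap S p); rewrite -fmapM pi fmap1.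
Qed.

Lemma fmap_biproduct A B Y : biproduct A B Y -> biproduct (S A) (S B) (S Y).
Proof.
move=> [i [j [p [q [pi pj qi qj e]]]]].
exists (fmap S i), (fmap S j), (fmap S p), (fmap S q).
by split; rewrite -!fmapM ?pi ?pj ?qi ?qj ?fmap1 ?raddf0 // -raddfD e fmap1.
Qed.

Lemma fmap_zero O : is_zero O -> is_zero (S O).
Proof. by move/is_zeroP=> O0; apply/is_zeroP; rewrite -fmap1 O0 raddf0. Qed.

Hypothesis Seq : is_equivalence S.

Lemma equiv_faithful X Y (f g : hom X Y) : fmap S f = fmap S g -> f = g.
Proof.
have [U [eta [_ [eta_iso etaN _ _]]]] := Seq.
move=> fg; have [t [te _]] := eta_iso Y.
by rewrite -[f]comp1m -[g]comp1m -te -!compmA -!etaN fg.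
Qed.

Lemma equiv_full X Y (g : hom (S X) (S Y)) : exists f, fmap S f = g.
Proof.
have [U [eta [eps [eta_iso etaN eps_iso epsN]]]] := Seq.
have [t [te et]] := eta_iso Y; have [s [se es]] := eta_iso X.
exists (t ∘ fmap U g ∘ eta X).
have Ufg : fmap U (fmap S (t ∘ fmap U g ∘ eta X)) = fmap U g.
  rewrite -[LHS]compm1 -[RHS]compm1 -es !compmA etaN.
  by rewrite !compmA et comp1m.
have [r [_ er]] := eps_iso (S X).
by rewrite -[LHS]compm1 -[RHS]compm1 -er !compmA !epsN Ufg.
Qed.

Lemma equiv_ess_surj Y : exists X, isomorphic (S X) Y.
Proof.
have [U [_ [eps [_ _ eps_iso _]]]] := Seq.
by exists (U Y), (eps Y).
Qed.

Lemma equiv_retract A X : retract (S A) (S X) -> retract A X.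
Proof.
move=> [i [p pi]]; have [i' i'E] := equiv_full i; have [p' p'E] := equiv_full p.
by exists i', p'; apply: equiv_faithful; rewrite fmapM i'E p'E fmap1.
Qed.

End Equivalence.

(** * Exactness and split triangles *)

Section Triangles.
Variable T : triangulated.
Implicit Types A B E P Q W X Y Z : T.

Notation S := (@shift T).
Let Seq := shift_equiv T.

Lemma dist_iso3 X Y Z Z' (u : hom X Y) (v : hom Y Z) (w : hom Z (S X))
    (c : hom Z Z') (c' : hom Z' Z) : inverse_of c c' ->
  dist u v w -> dist u (c ∘ v) (w ∘ c').
Proof.
move=> [c'c cc']; apply: (dist_iso (a := idm X) (b := idm Y) (c := c)).
- exact: is_iso_idm.
- exact: is_iso_idm.
- by exists c'.
- by rewrite comp1m compm1.
- by rewrite compm1.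
by rewrite fmap1 comp1m -compmA c'c compm1.
Qed.

(** Every morphism is the second morphism of a distinguished triangle. *)
Lemma dist_cocone X Y (f : hom X Y) :
  exists Z (u : hom Z X) (w : hom Y (S Z)), dist u f w.
Proof.
have [Z [v [w fvw]]] := dist_ex f.
have [Z' [c [c' [c'c cc']]]] := equiv_ess_surj Seq Z.
have := dist_iso3 (conj cc' c'c) fvw.
have [u uE] := equiv_full Seq (- (w ∘ c)).
exists Z', u, (c' ∘ v); apply/dist_rot; rewrite uE opprK; exact: H.
Qed.

Section Exactness.
Variables (X Y Z : T) (u : hom X Y) (v : hom Y Z) (w : hom Z (S X)).
Hypothesis uvw : dist u v w.

Lemma dist_comp0 : v ∘ u = 0.
Proof.
have [[O O0] _] := tcat_additive T.
have [c [cE _]] := dist_mor (a := idm X) (b := u) (dist_id X O0) uvw erefl.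
by rewrite -cE compm0.
Qed.

Lemma dist_exact W (f : hom W Y) : v ∘ f = 0 -> exists g, u ∘ g = f.
Proof.
move=> vf; have [[O O0] _] := tcat_additive T.
have d1 := (dist_rot _ _ _).1 (dist_id W O0).
have d2 := (dist_rot _ _ _).1 uvw.
have [|c [_]] := dist_mor (a := f) (b := (0 : hom O Z)) d1 d2.
  by rewrite compm0 vf.
rewrite fmap1 compmN compm1 compNm => /oppr_inj.
have [g <-] := equiv_full Seq c; rewrite -fmapM => fE.
by exists g; apply/esym/(equiv_faithful Seq).
Qed.

End Exactness.

Lemma dist_exact2 X Y Z (u : hom X Y) (v : hom Y Z) (w : hom Z (S X)) W
    (f : hom W Z) : dist u v w -> w ∘ f = 0 -> exists g, v ∘ g = f.
Proof. by move/dist_rot => d; apply: (dist_exact d). Qed.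

Lemma dist_exact3 X Y Z (u : hom X Y) (v : hom Y Z) (w : hom Z (S X)) W
    (f : hom W (S X)) : dist u v w -> fmap S u ∘ f = 0 -> exists g, w ∘ g = f.
Proof.
move/dist_rot/dist_rot=> d uf; apply: (dist_exact d).
by rewrite compNm uf oppr0.
Qed.

Lemma dist_comp02 X Y Z (u : hom X Y) (v : hom Y Z) (w : hom Z (S X)) :
  dist u v w -> w ∘ v = 0.
Proof. by move/dist_rot/dist_comp0. Qed.

Lemma dist_comp03 X Y Z (u : hom X Y) (v : hom Y Z) (w : hom Z (S X)) :
  dist u v w -> fmap S u ∘ w = 0.
Proof.
move/dist_rot/dist_rot/dist_comp0; rewrite compNm => /eqP.
by rewrite oppr_eq0 => /eqP.
Qed.

Lemma dist_split X Y Z (u : hom X Y) (v : hom Y Z) (w : hom Z (S X)) :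
  dist u v w -> w = 0 -> exists r s, bieq u s r v.
Proof.
move=> d w0; have [|s vs] := dist_exact2 (f := idm Z) d.
  by rewrite w0 comp0m.
have um W (x : hom W X) : u ∘ x = 0 -> x = 0.
  move=> ux; have [|y wy] := dist_exact3 (f := fmap S x) d.
    by rewrite -fmapM ux raddf0.
  by apply: (equiv_faithful Seq); rewrite -wy w0 comp0m raddf0.
have [|r ur] := dist_exact (f := idm Y - s ∘ v) d.
  by rewrite compmBr compmA vs compm1 comp1m subrr.
exists r, s; split=> //.
- apply/eqP; rewrite -subr_eq0; apply/eqP/um.
  rewrite compmBr compmA ur compmBl comp1m compm1 -compmA.
  by rewrite (dist_comp0 d) compm0 subr0 subrr.
- by apply: um; rewrite compmA ur compmBl comp1m -compmA vs compm1 subrr.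
- exact: dist_comp0 d.
by rewrite ur subrK.
Qed.

(** * Extensions of objects *)

(** Some distinguished triangle has the objects [X], [Y], [Z]; that is, [Y] is
    an extension of [Z] by [X]. *)
Definition tri X Y Z := exists u v w, @dist T X Y Z u v w.

Lemma tri_iso X Y Z X' Y' Z' : isomorphic X X' -> isomorphic Y Y' ->
  isomorphic Z Z' -> tri X Y Z -> tri X' Y' Z'.
Proof.
move=> [a [a' [a'a aa']]] [b [b' [b'b bb']]] [c [c' [c'c cc']]] [u [v [w d]]].
exists (b ∘ u ∘ a'), (c ∘ v ∘ b'), (fmap S a ∘ w ∘ c').
apply: (dist_iso (a := a) (b := b) (c := c)) d.
- by exists a'.
- by exists b'.
- by exists c'.
- by rewrite -compmA a'a compm1.
- by rewrite -compmA b'b compm1.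
by rewrite -compmA c'c compm1.
Qed.

Lemma tri_rot X Y Z : tri X Y Z -> tri Y Z (S X).
Proof.
move=> [u [v [w d]]]; exists v, w, (- fmap S u); exact/(dist_rot _ _ _).1.
Qed.

Lemma tri_rotV X Y Z : tri X Y (S Z) -> tri Z X Y.
Proof.
move=> [u [v [w d]]]; have [f fE] := equiv_full Seq (- w).
by exists f, u, v; apply/dist_rot; rewrite fE opprK.
Qed.

Lemma tri_shift X Y Z : tri X Y Z -> tri (S X) (S Y) (S Z).
Proof. by move/tri_rot/tri_rot/tri_rot. Qed.

Lemma tri_unshift X Y Z : tri (S X) Y (S Z) -> exists2 Y', tri X Y' Z &
  isomorphic (S Y') Y.
Proof.
move=> d; have [Y' Y'Y] := equiv_ess_surj Seq Y; exists Y' => //.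
do 3 apply: tri_rotV.
apply: tri_iso d; try exact: isomorphic_refl.
exact: isomorphic_sym.
Qed.

Lemma tri0 X O : is_zero O -> tri X X O.
Proof. by move=> O0; exists (idm X), 0, 0; apply: dist_id. Qed.

(** Comparing [B] with the cone of the inclusion [A -> Y]. *)
Lemma biproduct_tri A B Y : biproduct A B Y -> tri A Y B.
Proof.
move=> [i [j [p [q [pi pj qi qj e]]]]].
have [Z [v [w d]]] := dist_ex i.
have w0 : w = 0.
  rewrite -[w]comp1m -fmap1 -pi fmapM -compmA.
  by rewrite (dist_comp03 d) compm0.
have [r [s [ri rs vi vs e']]] := dist_split d w0.
exists i, (q ∘ s ∘ v), (w ∘ (v ∘ j)); apply: dist_iso3 d; split.
  have -> : v ∘ j ∘ (q ∘ s) = v ∘ (j ∘ q) ∘ s by rewrite !compmA.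
  have -> : j ∘ q = idm Y - i ∘ p by rewrite -e addrC addKr.
  by rewrite compmBr compm1 compmA vi comp0m subr0.
have -> : q ∘ s ∘ (v ∘ j) = q ∘ (s ∘ v) ∘ j by rewrite !compmA.
have -> : s ∘ v = idm Y - i ∘ r by rewrite -e' addrC addKr.
by rewrite compmBr compm1 compmA qi comp0m subr0.
Qed.

(** A triangle whose connecting morphism is forced to vanish splits. *)
Lemma tri_biproduct X Y Z : (forall f : hom Z (S X), f = 0) -> tri X Y Z ->
  biproduct X Z Y.
Proof.
move=> h [u [v [w d]]]; have [r [s b]] := dist_split d (h w).
by exists u, s, r, v.
Qed.

(** In a triangulated category retracts have complements. *)
Lemma retract_biproduct A X : retract A X -> exists B, biproduct A B X.
Proof.
move=> [i [p pi]]; have [B [v [w d]]] := dist_ex i.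
have w0 : w = 0.
  rewrite -[w]comp1m -fmap1 -pi fmapM -compmA.
  by rewrite (dist_comp03 d) compm0.
have [r [s b]] := dist_split d w0.
by exists B, i, s, r, v.
Qed.

(** The octahedral axiom gives one half of the associativity of extensions;
    the other half is the octahedral axiom for the rotated triangles. *)
Lemma tri_assocl X Y Z Z' X' : tri X Y Z' -> tri Y Z X' ->
  exists2 Y', tri Z' Y' X' & tri X Z Y'.
Proof.
move=> [f [i [j d1]]] [g [k [l d2]]].
have [Y' [m [n d3]]] := dist_ex (g ∘ f).
have [u [v [d4 _]]] := dist_oct d1 d2 d3.
by exists Y'; [exists u, v, (fmap S i ∘ l) | exists (g ∘ f), m, n].
Qed.

Lemma tri_assocr X Z Y' Z' X' : tri X Z Y' -> tri Z' Y' X' ->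
  exists2 Y, tri X Y Z' & tri Y Z X'.
Proof.
move=> d1 d2; have [W d3 d4] := tri_assocl (tri_rot d1) (tri_rot d2).
have [Y d5 YW] := tri_unshift d3; exists Y => //; apply: tri_rotV.
apply: tri_iso d4; try exact: isomorphic_refl.
exact: isomorphic_sym.
Qed.

Lemma hom0_retract A X W : retract A X -> (forall f : hom W X, f = 0) ->
  forall f : hom W A, f = 0.
Proof.
by move=> [i [p pi]] h f; rewrite -[f]comp1m -pi -compmA (h (i ∘ f)) compm0.
Qed.

Lemma hom0_tri X Y Z W : tri X Y Z -> (forall f : hom W X, f = 0) ->
  (forall f : hom W Z, f = 0) -> forall f : hom W Y, f = 0.
Proof.
move=> [u [v [w d]]] hX hZ f; have [g <-] := dist_exact d (hZ (v ∘ f)).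
by rewrite (hX g) compm0.
Qed.

Lemma iter_shift_iso k X Y :
  isomorphic X Y -> isomorphic (iter k S X) (iter k S Y).
Proof. by elim: k => //= k IH XY; apply/fmap_iso/IH. Qed.

Lemma iter_shift_retract k A X :
  retract A X -> retract (iter k S A) (iter k S X).
Proof. by elim: k => //= k IH AX; apply/fmap_retract/IH. Qed.

Lemma iter_shift_zero k O : is_zero O -> is_zero (iter k S O).
Proof. by elim: k => //= k IH O0; apply/fmap_zero/IH. Qed.

Lemma iter_shift_tri k X Y Z :
  tri X Y Z -> tri (iter k S X) (iter k S Y) (iter k S Z).
Proof. by elim: k => //= k IH d; apply/tri_shift/IH. Qed.

(** Let [C] be the cone of a morphism [P -> E], with no nonzero morphisms from
    [P] to [C], and [A] a retract of [E].  The cone [C'] of the composite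
    [P -> E -> A] is a retract of [C ⊕ P[1]]: morphisms of triangles
    given by [A -> E] and [E -> A] compose to an endomorphism of [C'] that
    differs from the identity by a morphism through [P[1]] and one of square
    zero. *)
Lemma retract_cone P E A Cn (f : hom P E) (w : hom E Cn) n (e : hom A E)
    (r : hom E A) C' (w' : hom A C') n' V :
  dist f w n -> (forall g : hom P Cn, g = 0) -> r ∘ e = idm A ->
  dist (r ∘ f) w' n' -> biproduct Cn (S P) V -> retract C' V.
Proof.
move=> d hP re d' [iC [iP [pC [pP [piC pCP pPC pPP _]]]]].
have [t ft] := dist_exact d (hP (w ∘ (e ∘ (r ∘ f)))).
have [c [cw nc]] := dist_mor d' d (esym ft).
have [|c' [c'w' n'c']] := dist_mor (a := idm P) (b := r) d d'.
  by rewrite compm1.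
move: n'c'; rewrite fmap1 comp1m => n'c'.
have [|s n's] := dist_exact3 (f := fmap S (idm P - t)) d'.
  by rewrite -fmapM compmBr compm1 -compmA ft !compmA re comp1m subrr raddf0.
pose z := idm C' - (c' ∘ c + s ∘ n').
have n'z : n' ∘ z = 0.
  rewrite compmBr compm1 compmDr !compmA -n'c' -nc n's -compmDl -raddfD.
  by rewrite (addrC t) subrK fmap1 comp1m subrr.
have zw : z ∘ w' = 0.
  rewrite compmBl comp1m compmDl -!compmA cw (dist_comp02 d') compm0 addr0.
  by rewrite (compmA c') c'w' -compmA re compm1 subrr.
have zz : z ∘ z = 0.
  by have [y {2}<-] := dist_exact2 d' n'z; rewrite compmA zw comp0m.
exists (iC ∘ c + iP ∘ n'), ((idm C' + z) ∘ (c' ∘ pC + s ∘ pP)).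
rewrite -compmA.
have -> : (c' ∘ pC + s ∘ pP) ∘ (iC ∘ c + iP ∘ n') = idm C' - z.
  rewrite /z subKr compmDl !compmDr !compmA.
  rewrite !(compK piC, compK pCP, compK pPC, compK pPP) !compm1 !compm0 !comp0m.
  by rewrite addr0 add0r.

by rewrite compmDl comp1m compmBr compm1 zz subr0 subrK.
Qed.

(** Integer functions that are additive on triangles; these are the
    homomorphisms from the Grothendieck group of [T] to the integers. *)
Definition tri_additive (f : T -> int) :=
  forall X Y Z, tri X Y Z -> f Y = f X + f Z.

Lemma tri_additive_split f : tri_additive f -> split_additive f.
Proof. by move=> fD A B Y /biproduct_tri; apply: fD. Qed.

Lemma tri_additive_iso f X Y : tri_additive f -> isomorphic X Y -> f X = f Y.
Proof.
by move/tri_additive_split; apply: split_additive_iso; apply: tcat_additive.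
Qed.

Lemma tri_additive_shift f X k :
  tri_additive f -> f (iter k S X) = (-1) ^+ k * f X.
Proof.
move=> fD; elim: k => [|k IH] /=; first by rewrite mul1r.
have [[O O0] _] := tcat_additive T; set Y := iter k S X in IH *.
have := fD _ _ _ (tri_rot (tri0 Y O0)).
rewrite (split_additive0 (tri_additive_split fD) O0) => /esym/eqP.
by rewrite addrC addr_eq0 exprS mulN1r mulNr -IH => /eqP.
Qed.

End Triangles.


(** * The additive closure of an object *)

Section AdditiveClosure.
Variables (T : triangulated) (M : T).
Implicit Types A B L O P Q X Y Z : T.
Notation S := (@shift T).

(** The objects of add [M]: retracts of finite direct sums of copies of [M]. *)
Inductive add_closure : T -> Prop :=
| add_self : add_closure M
| add_zero O : is_zero O -> add_closure O
| add_sum A B Y :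
    biproduct A B Y -> add_closure A -> add_closure B -> add_closure Y
| add_retract A X : retract A X -> add_closure X -> add_closure A.

Lemma add_hom0 Q Y : add_closure Q -> (forall f : hom M Y, f = 0) ->
  forall f : hom Q Y, f = 0.
Proof.
move=> aQ h; elim: Q / aQ => //
  [O O0|A B X [i [j [p [q [_ _ _ _ e]]]]] _ hA _ hB|A X [i [p pi]] _ hX] f.
- exact: (O0 Y).1.
- rewrite -[f]compm1 -e compmDr !compmA (hA (f ∘ i)) (hB (f ∘ j)).
  by rewrite !comp0m addr0.
by rewrite -[f]compm1 -pi compmA (hX (f ∘ p)) comp0m.
Qed.

Lemma add_local_retract L Q : local_ring (endo L) -> add_closure Q ->
  retract L Q -> retract L M.
Proof.
move=> Lloc aQ; elim: Q / aQ => // [O O0|A B X AB _ hA _ hB|A X AX _ hX] LX.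
- by case: (local_nonzero Lloc (retract_zero O0 LX)).
- by have [] := local_retract_biproduct Lloc AB LX.
exact/hX/(retract_trans LX).
Qed.

Lemma add_iso X Y : isomorphic X Y -> add_closure X -> add_closure Y.
Proof. by move/isomorphic_sym/iso_retract; apply: add_retract. Qed.

End AdditiveClosure.

(** * Filtrations by shifts of a presilting object *)

Section Filtrations.
Variables (T : triangulated) (M : T).
Hypothesis M_presilting :
  forall i, (0 < i)%N -> forall f : hom M (iter i shift M), f = 0.
Variable m : T -> int.
Hypothesis mD : split_additive m.
Implicit Types A E O P Q X Y Z : T.
Notation S := (@shift T).
Let Seq := shift_equiv T.
Let addT := tcat_additive T.

(** [filt l X v]: the object [X] is an iterated extension of objects [P_i[i]],
    [0 <= i <= l], with [P_i] in add [M] and with smaller shifts as subobjects,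
    and [v] is the alternating sum of the [m P_i] for such a filtration.
    One step is a triangle [P -> X -> Z[1]], recorded as its rotation
    [Z -> P -> X]. *)
Fixpoint filt (l : nat) X (v : int) : Prop :=
  if l is l'.+1 then exists Z P v',
    [/\ tri Z P X, add_closure M P, filt l' Z v' & v = m P - v']
  else add_closure M X /\ v = m X.

(** There are no nonzero morphisms from [M] to a positive shift of [X]. *)
Definition positive X := forall k (f : hom M (iter k.+1 S X)), f = 0.

Lemma positive_tri X Y Z : tri X Y Z -> positive X -> positive Z -> positive Y.
Proof. by move=> d pX pZ k; apply: hom0_tri (iter_shift_tri k.+1 d) _ _. Qed.

Lemma add_positive P : add_closure M P -> positive P.
Proof.
move=> aP; elim: P / aP => [|O O0|A B X AB _ hA _ hB|A X AX _ hX].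
- by move=> k; apply: M_presilting.
- by move=> k; have [_] := iter_shift_zero k.+1 O0 M.
- exact: positive_tri (biproduct_tri AB) hA hB.
by move=> k; apply: hom0_retract (iter_shift_retract k.+1 AX) (hX k).
Qed.

Lemma filt_positive l X v : filt l X v -> positive X.
Proof.
elim: l X v => [|l IH] X v /=; first by case=> /add_positive.
move=> [Z [P [v' [/tri_rot d /add_positive pP /IH pZ _]]]].
by apply: positive_tri d pP _ => k; rewrite -iterSr; apply: pZ.
Qed.

Lemma filt_hom0 l X v Q : filt l X v -> add_closure M Q ->
  forall f : hom Q (S X), f = 0.
Proof. by move=> /filt_positive pX aQ; apply: add_hom0 aQ (pX 0). Qed.

Lemma filt_iso l X Y v : isomorphic X Y -> filt l X v -> filt l Y v.
Proof.
case: l => [|l] XY /=.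
  by move=> [aX ->]; split; [apply: add_iso XY aX | apply: split_additive_iso].
move=> [Z [P [v' [d aP fZ ->]]]]; exists Z, P, v'; split=> //.
by apply: tri_iso d => //; apply: isomorphic_refl.
Qed.

Lemma filt_add l P : add_closure M P -> filt l P (m P).
Proof.
elim: l P => [//|l IH] P aP /=; have [[O O0] _] := addT.
exists O, P, 0; split=> //; last by rewrite subr0.
  by apply/tri_rotV/tri0/fmap_zero.
by rewrite -(split_additive0 mD O0); apply/IH/add_zero.
Qed.

Lemma filtS l X v : filt l X v -> filt l.+1 X v.
Proof.
elim: l X v => [|l IH] X v; first by case=> aX ->; apply: filt_add.
by move=> [Z [P [v' [d aP /IH fZ ->]]]]; exists Z, P, v'.
Qed.

Lemma filt_leq l l' X v : (l <= l')%N -> filt l X v -> filt l' X v.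
Proof.
by move/subnK <-; elim: (_ - _)%N => //= k IH /IH; apply: filtS.
Qed.

Lemma filt_shift l X v : filt l X v -> filt l.+1 (S X) (- v).
Proof.
move=> fX; have [[O O0] _] := addT; exists X, O, v; split=> //.
- exact/tri_rot/tri0.
- exact: add_zero.
by rewrite (split_additive0 mD O0) add0r.
Qed.

Lemma filt_iter l X v k :
  filt l X v -> filt (k + l) (iter k S X) ((-1) ^+ k * v).
Proof.
move=> fX; elim: k => [|k IH]; first by rewrite mul1r.
by rewrite exprS mulN1r mulNr; apply: filt_shift.
Qed.

(** Filtrations with nonnegative factors are closed under extensions: by
    orthogonality the factors can be reordered by increasing shift. *)
Lemma filt_tri l X Y Z x z : tri X Y Z -> filt l X x -> filt l Z z ->
  filt l Y (x + z).
Proof.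
elim: l X Y Z x z => [|l IH] X Y Z x z d.
  move=> fX [aZ ->]; have b := tri_biproduct (filt_hom0 fX aZ) d.
  by case: fX => aX ->; split; [apply: add_sum b aX aZ | rewrite (mD b)].
move=> fX [Z' [Q [z' [dZ aQ fZ' ->]]]].
have [V dV dV'] := tri_assocr d (tri_rot dZ).
have /biproductC/biproduct_tri {}dV := tri_biproduct (filt_hom0 fX aQ) dV.
have [X' [P [x' [dX aP fX' ->]]]] := fX.
have [U dU dU'] := tri_assocr dV (tri_rot dX).
have bU := tri_biproduct (filt_hom0 (filt_add 0 aQ) aP) dU.
have [W' dW' dY] := tri_assocl dU' dV'.
have [W dW WW'] := tri_unshift dW'.
exists W, U, (x' + z'); split.
- apply: tri_rotV; apply: tri_iso dY; try exact: isomorphic_refl.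
  exact: isomorphic_sym.
- exact: add_sum bU aQ aP.
- exact: IH dW fX' fZ'.
by rewrite (mD bU) opprD addrACA (addrC (m P)).
Qed.

(** A version of Schanuel's lemma: for triangles [Z -> P -> X] and
    [Z' -> P' -> X] there is an object [V] that is an extension of [P'] by [Z]
    and of [P] by [Z']; both sides then compute its alternating sum. *)
Lemma filt_unique l X v v' : filt l X v -> filt l X v' -> v = v'.
Proof.
elim: l X v v' => [X v v' [_ ->] [_ ->] //|l IH] X v v'.
move=> [Z [P [z [d aP fZ ->]]]] [Z' [P' [z' [d' aP' fZ' ->]]]].
have [V dV /tri_rotV dV'] := tri_assocr d (tri_rot d').
have e := IH _ _ _ (filt_tri dV fZ (filt_add _ aP'))
  (filt_tri dV' fZ' (filt_add _ aP)).
by apply/eqP; rewrite subr_eq addrAC eq_sym subr_eq addrC e addrC.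
Qed.

(** A retract [A] of [E] with a filtration [Z -> P -> E] is approximated by the
    same [P], and the third object of the resulting triangle is a retract of
    [Z ⊕ P]. *)
Lemma filt_retract l A E v :
  retract A E -> filt l E v -> exists v', filt l A v'.
Proof.
elim: l A E v => [|l IH] A E v AE.
  by case=> aE _; exists (m A); split=> //; apply: add_retract AE aE.
move=> [Z [P [z [[u [f [w d]]] aP fZ _]]]]; have [e [r re]] := AE.
have [Z' [u' [w' d']]] := dist_cocone (r ∘ f).
have [V [i [j /coproduct2_biproductW b]]] := addT.2 Z P.
have ZV : retract Z' V.
  apply: (equiv_retract Seq); apply: retract_cone re _ (fmap_biproduct S b).
  - exact: (dist_rot _ _ _).1 d.
  - exact: filt_hom0 fZ aP.
  exact: (dist_rot _ _ _).1 d'.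
have [z' fZ'] := IH _ _ _ ZV (filt_tri (biproduct_tri b) fZ (filt_add l aP)).
by exists (m P - z'), Z', P, z'; split=> //; exists u', (r ∘ f), w'.
Qed.

(** [v] is the alternating sum of [m] for a filtration of [X] by shifts of
    objects of add [M] in arbitrary degrees; nonnegative degrees are reached by
    shifting [X]. *)
Definition shifted_filt X v := exists k l, filt l (iter k S X) ((-1) ^+ k * v).

(** All sufficiently large shifts and lengths can be used. *)
Lemma shifted_filt_leq X v : shifted_filt X v ->
  exists n, forall k l, (n <= k)%N -> (n + k <= l)%N ->
    filt l (iter k S X) ((-1) ^+ k * v).
Proof.
move=> [k0 [l0 fX]]; exists (k0 + l0)%N => k l nk nkl.
have k0k : (k0 <= k)%N by apply: leq_trans nk; apply: leq_addr.
rewrite -(subnK k0k) iterD exprD -mulrA.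
apply: filt_leq (filt_iter (k - k0) fX).
apply: leq_trans nkl; rewrite addnC leq_add ?leq_subr //.
exact: leq_addl.
Qed.

Lemma shifted_filt_unique X v v' :
  shifted_filt X v -> shifted_filt X v' -> v = v'.
Proof.
move=> /shifted_filt_leq[n fX] /shifted_filt_leq[n' fX'].
pose k := (n + n')%N; have nk : (n <= k)%N := leq_addr _ _.
have nk' : (n' <= k)%N := leq_addl _ _.
have := filt_unique (fX k (k + k)%N nk (leq_add nk (leqnn k)))
   (fX' k (k + k)%N nk' (leq_add nk' (leqnn k))).
exact/(can_inj (signrMK k)).
Qed.

Lemma shifted_filt_tri X Y Z x z : tri X Y Z ->
  shifted_filt X x -> shifted_filt Z z -> shifted_filt Y (x + z).
Proof.
move=> d /shifted_filt_leq[n fX] /shifted_filt_leq[n' fZ].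
pose k := (n + n')%N; have nk : (n <= k)%N := leq_addr _ _.
have nk' : (n' <= k)%N := leq_addl _ _.
exists k, (k + k)%N; rewrite mulrDr; apply: filt_tri (iter_shift_tri k d) _ _.
  exact: fX nk (leq_add nk (leqnn k)).
exact: fZ nk' (leq_add nk' (leqnn k)).
Qed.

Lemma shifted_filtP X k l v : filt l (iter k S X) v -> 
  shifted_filt X ((-1) ^+ k * v).
Proof. by move=> fX; exists k, l; rewrite signrMK. Qed.

Lemma thick_filt : @thick T [set X | exists v, shifted_filt X v].
Proof.
split=> /=.
- move=> O O0; exists (m O), 0%N, 0%N; rewrite mul1r; apply: filt_add.
  exact: add_zero.
- move=> X Y XY [v [k [l fX]]]; exists v, k, l.
  by apply: filt_iso fX; apply: iter_shift_iso.
- move=> X; split=> -[v [k [l]]].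
    move/filt_shift; rewrite -iterS iterSr => /shifted_filtP fX.
    by eexists; apply: fX.
  by rewrite -iterSr => /shifted_filtP fX; eexists; apply: fX.
- move=> X Y Z u w t d [x fX] [y fY].
  have dR : tri Y Z (S X) by apply: tri_rot; exists u, w, t.
  have [k [l]] := fX.
  move/filt_shift; rewrite -iterS iterSr => /shifted_filtP fSX.
  by eexists; apply: shifted_filt_tri dR fY fSX.
move=> A X /summand_retract/iter_shift_retract AX [v [k [l]]].
by move/(filt_retract (AX k)) => [v'] /shifted_filtP fA; eexists; apply: fA.
Qed.

Lemma filt_total X :
  smallest (@thick T) [set M] = setT -> exists v, shifted_filt X v.
Proof.
move=> gen; have sX : smallest (@thick T) [set M] X by rewrite gen.
apply: (sX [set X | exists v, shifted_filt X v]).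
split; first exact: thick_filt.
move=> _ ->; exists (m M), 0%N, 0%N; rewrite mul1r.
exact/filt_add/add_self.
Qed.

End Filtrations.

(** * The Grothendieck group *)

(** A split additive function agrees on add [M] with one that is additive on
    triangles.  Applied to multiplicities, this says that the classes of the
    indecomposable summands of [M] are linearly independent in the Grothendieck
    group. *)
Lemma split_additive_extend (T : triangulated) (M : T) (m : T -> int) :
  silting M -> split_additive m ->
  exists2 f : T -> int, tri_additive f & forall P, add_closure M P -> f P = m P.
Proof.
move=> [Mpos gen] mD; pose f X := projT1 (cid (filt_total Mpos mD X gen)).
have fE X v : shifted_filt M m X v -> f X = v.
  move=> fX; rewrite /f; case: cid => v' /= fX'.
  exact (shifted_filt_unique Mpos mD fX' fX).
have ff X : shifted_filt M m X (f X) by rewrite /f; case: cid.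
exists f => [X Y Z d|P aP]; apply: fE; first exact: shifted_filt_tri d _ _.
by exists 0%N, 0%N; rewrite mul1r; apply: filt_add.
Qed.

(** The classes of the indecomposable summands of a silting object span the
    Grothendieck group, in the sense that they determine the value of every
    additive function by a fixed integral combination. *)
Lemma silting_span (T : triangulated) (M : T) n (L : 'I_n -> T) :
  krull_schmidt T -> silting M ->
  (forall A, local_ring (endo A) -> retract A M ->
    exists j, isomorphic A (L j)) ->
  forall X, exists b : 'I_n -> int,
    forall f : T -> int, tri_additive f -> f X = \sum_j b j * f (L j).
Proof.
move=> KS [Mpos gen] hL X.
(* Only the existence of filtrations is used, so any [m] will do. *)
pose m (_ : T) : int := 0.
have mD : split_additive m by move=> A B Y _; rewrite addr0.
pose spanned Y := exists b : 'I_n -> int,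
  forall f : T -> int, tri_additive f -> f Y = \sum_j b j * f (L j).
have span_add P : add_closure M P -> spanned P.
  move=> aP; apply: (krull_schmidt_ind (tcat_additive T) KS).
  - move=> O O0; exists (fun=> 0) => f fD.
    rewrite big1 => [|j _]; last exact: mul0r.
    exact: split_additive0 (tri_additive_split fD) O0.
  - move=> A B Y AB [a ha] [b hb]; exists (fun j => a j + b j) => f fD.
    rewrite (tri_additive_split fD AB) ha // hb // -big_split.
    by apply: eq_bigr => j _; rewrite mulrDl.
  move=> A Aloc AP; have [j Aj] := hL A Aloc (add_local_retract Aloc aP AP).
  exists (fun i => (i == j)%:R) => f fD; rewrite (bigD1 j) //= eqxx mul1r.
  rewrite big1 => [|i /negPf ->]; last exact: mul0r.
  by rewrite addr0; apply: tri_additive_iso.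
have span_filt l Y v : filt M m l Y v -> spanned Y.
  elim: l Y v => [|l IH] Y v; first by case=> /span_add.
  move=> [Z [P [z [d /span_add[a ha] /IH[b hb] _]]]].
  exists (fun j => a j - b j) => f fD.
  have -> : f Y = f P - f Z by rewrite (fD _ _ _ d) addrC addKr.
  by rewrite ha // hb // -sumrB; apply: eq_bigr => j _; rewrite mulrBl.
have [v [k [l /span_filt[b hb]]]] := filt_total Mpos mD X gen.
exists (fun j => (-1) ^+ k * b j) => f fD.
rewrite -[LHS](signrMK k) -tri_additive_shift // hb // mulr_sumr.
by apply: eq_bigr => j _; rewrite mulrA.
Qed.

(** Representatives of the indecomposable summands, with local endomorphism
    rings. *)
Lemma ind_summands_enum (T : triangulated) (M : T) : krull_schmidt T ->
  exists L : 'I_(delta M) -> T, [/\ forall j, local_ring (endo (L j)),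
    forall j, retract (L j) M, forall i j, isomorphic (L i) (L j) -> i = j &
    forall A, local_ring (endo A) -> retract A M ->
      exists j, isomorphic A (L j)].
Proof.
move=> KS; have addT := tcat_additive T.
have fin := finite_ind_summands M addT KS.
rewrite /delta; set s := fset_set _.
have sP c : (c \in s) <-> ind_summands M c.
  by rewrite /s in_fset_set // inE.
pose c (i : 'I_#|` s|) : set T := nth (set0 : {classic set T}) s i.
have cs i : ind_summands M (c i) by apply/sP; apply: mem_nth.
have /choice[L hL] : forall i, exists L : T,
    [/\ local_ring (endo L), retract L M & c i = iso_class L].
  move=> i; have [A [indA /summand_retract AM] <-] := cs i.
  have [L [Lloc AL]] := indecomposable_local addT KS indA; exists L; split=> //.
    by apply: retract_trans AM; apply/iso_retract/isomorphic_sym.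
  exact: iso_class_eq.
exists L; split=> [j|j|i j /iso_class_eq Lij|A].
- by have [] := hL j.
- by have [] := hL j.
- have [[_ _ ci] [_ _ cj]] := (hL i, hL j).
  apply/val_inj/eqP.
  rewrite -(nth_uniq (set0 : {classic set T}) (ltn_ord i) (ltn_ord j)
    (fset_uniq s)).
  by apply/eqP; rewrite -/(c i) -/(c j) ci cj Lij.
move=> Aloc AM; have /sP As : ind_summands M (iso_class A).
  exists A => //; split; first exact: local_indecomposable.
  by have [B /biproduct_summand] := retract_biproduct AM.
have Ai : (index (iso_class A : {classic set T}) s < #|` s|)%N.
  by rewrite index_mem.
exists (Ordinal Ai); have [_ _] := hL (Ordinal Ai).
rewrite /c nth_index // => cA.
suff : (iso_class A : set T) (L (Ordinal Ai)) by [].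
have := isomorphic_refl (L (Ordinal Ai)).
by rewrite -[isomorphic _ _]/(iso_class _ _) -cA.
Qed.

(** The classes of the summands [L i] of [M] are combinations, with matrix [B],
    of those of the summands [K j] of [N].  Additive functions dual to the [L i]
    evaluate on the [K j] to a right inverse of [B], so [B] has at least as many
    columns as rows. *)
Lemma silting_delta_le (T : triangulated) (M N : T) : krull_schmidt T ->
  silting M -> silting N -> (delta M <= delta N)%N.
Proof.
move=> KS hM hN.
have [L [Lloc LM Linj _]] := ind_summands_enum M KS.
have [K [_ _ _ KN]] := ind_summands_enum N KS.
have /choice[b hb] := fun i => silting_span KS hN KN (L i).
have /choice[f hf] : forall i, exists f : T -> int,
    tri_additive f /\ forall j, f (L j) = (j == i)%:R.
  move=> i; have [g [gD g1 g0]] := multiplicity (tcat_additive T) KS (Lloc i).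
  have [f fD fg] := split_additive_extend hM gD; exists f; split=> // j.
  rewrite fg; last exact: add_retract (LM j) (add_self M).
  have [->|ji] := eqVneq; first exact: g1.
  by apply: g0 => // /Linj /eqP; rewrite (negPf ji).
pose B : 'M[rat]_(delta M, delta N) := \matrix_(i, j) (b i j)%:~R.
pose A : 'M[rat]_(delta N, delta M) := \matrix_(j, i) (f i (K j))%:~R.
apply: (@mulmx1_min _ _ _ B A); apply/matrixP => i k; rewrite !mxE.
have [fD fL] := hf k.
transitivity ((f k (L i))%:~R : rat); last by rewrite fL; case: eqP.
rewrite (hb i (f k) fD) rmorph_sum; apply: eq_bigr => j _.
by rewrite !mxE rmorphM.
Qed.

Theorem corollary2p28 (T : triangulated) (hT : krull_schmidt T) (M N : T)
  (hM : silting M) (hN : silting N) : delta M = delta N.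
Proof. by apply/eqP; rewrite eqn_leq !silting_delta_le. Qed.
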